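(* Let $E$ be an evolution algebra with natural basis $\{e_1,\dots,e_n\}$ whose matrix in this basis has non-negative integer entries. Then $E$ is a complete evolution algebra if and only if there exists $k$ with $1\le k\le n$ such that $$(\dots((e_{i_1}e_{i_1})e_{i_2})\dots)e_{i_k}=e_1+\dots+e_{i_k-1}+e_{i_k+1}+\dots+e_n$$ for all $i_1,\dots,i_k\in\{1,\dots,n\}$.
   Context: An evolution algebra over a field $K$ is a vector space $E$ over $K$ with a bilinear multiplication and a basis $\{e_1,e_2,\dots\}$ (called a natural basis) such that $e_ie_j=0$ for $i\neq j$ and $e_ie_i=\sum_k a_{ik}e_k$; here $K=\mathbb{C}$. The matrix $(a_{ij})_{i,j=1}^n$ is called the matrix of $E$ in the natural basis $\{e_1,\dots,e_n\}$. The evolution algebra determined by a graph with $n$ vertices and adjacency matrix $(a_{ij})$ is the evolution algebra with natural basis $\{e_1,\dots,e_n\}$ and $e_ie_i=\sum_k a_{ik}e_k$. $E$ is a complete evolution algebra if it is determined by a complete graph, i.e. its matrix in the given natural basis is the adjacency matrix of $K_n$ ($a_{ii}=0$, $a_{ij}=1$ for $i\neq j$). For $k=1$ the left-hand side of the displayed identity is $e_{i_1}e_{i_1}$; for general $k$ it is the left-normed product of $e_{i_1},e_{i_1},e_{i_2},\dots,e_{i_k}$. *)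

(* Defs.v *)
From HB Require Import structures.
From mathcomp Require Import all_boot all_order all_algebra.
From mathcomp Require Import reals.
From mathcomp Require Export complex.

Set Implicit Arguments.
Unset Strict Implicit.
Unset Printing Implicit Defensive.

Import GRing.Theory.
Local Open Scope ring_scope.

Section EvolutionAlgebra.
Variables (K : fieldType) (E : vectType K) (mul : {bilinear E -> E -> E}).
Variables (n : nat) (e : n.-tuple E).

(* (E, mul) is an evolution algebra exactly when it has a natural basis. *)
Definition natural_basis : Prop :=
  basis_of fullv e /\
  (forall i j : 'I_n, i != j -> mul (tnth e i) (tnth e j) = 0).

(* Row i holds the coordinates of e_i e_i. *)
Definition evolution_mx : 'M[K]_n :=
  \matrix_(i, k) coord e k (mul (tnth e i) (tnth e i)).

Definition adjacency_mx (g : rel 'I_n) : 'M[K]_n :=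
  \matrix_(i, j) (g i j)%:R.

Definition determined_by_graph (g : rel 'I_n) : Prop :=
  natural_basis /\ evolution_mx = adjacency_mx g.

Definition complete_graph : rel 'I_n := fun i j => i != j.

Definition complete_evolution_algebra : Prop :=
  determined_by_graph complete_graph.

(* [left_normed i k] is ((e_(i 1) e_(i 1)) e_(i 2)) ... e_(i k): the index
   sequence starts at 1 and its first entry is used twice. *)
Fixpoint left_normed (i : nat -> 'I_n) (k : nat) : E :=
  if k is k'.+1 then mul (left_normed i k') (tnth e (i k)) else tnth e (i 1%N).

Lemma evolution_mxP (i : 'I_n) : natural_basis ->
  mul (tnth e i) (tnth e i) = \sum_(k < n) evolution_mx i k *: tnth e k.
Proof.
move=> [eB _]; rewrite [LHS](coord_basis eB (memvf _)).
by apply: eq_bigr => k _; rewrite mxE -(tnth_nth 0).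
Qed.

End EvolutionAlgebra.

(* Main.v *)
Require Import Defs.
From HB Require Import structures.
From mathcomp Require Import all_boot all_order all_algebra.
From mathcomp Require Import reals complex.
Import GRing.Theory.
Local Open Scope ring_scope.

(** For k = 1 the identity says that row i of the structure matrix a is
the indicator of the indices other than i, which is exactly completeness; so
only k >= 2 has to be excluded, and constant index sequences suffice for this.
Since e_i^2 e_i = a_ii e_i^2, the left-normed product along the constant
sequence i is a_ii^(k-1) e_i^2 ([left_normed_const]), hence the identity gives
a_ii^(k-1) a_ij = [i != j] for all j ([coord_left_normed_const]).  Taking j = i
yields a_ii = 0; when k >= 2, also n >= k >= 2, and any j different from i
then yields 0 = 1. *)

Section LeftNormed.
Set Implicit Arguments.
Variables (K : fieldType) (E : vectType K) (mul : {bilinear E -> E -> E}).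
Variables (n : nat) (e : n.-tuple E).
Hypothesis eB : natural_basis mul e.

Local Notation a := (evolution_mx mul e).

Lemma natural_basis_sqrM (i : 'I_n) :
  mul (mul (tnth e i) (tnth e i)) (tnth e i)
    = a i i *: mul (tnth e i) (tnth e i).
Proof.
have [_ e_orth] := eB.
rewrite {1}(evolution_mxP i eB) linear_sumlz (bigD1 i) //= linearZl_LR.
by rewrite big1 ?addr0 // => k ki; rewrite linearZl_LR /= e_orth ?scaler0.
Qed.

Lemma left_normed_const (i : 'I_n) (k : nat) :
  left_normed mul e (fun=> i) k.+1
    = a i i ^+ k *: mul (tnth e i) (tnth e i).
Proof.
elim: k => [|k IHk]; first by rewrite scale1r.
by rewrite [LHS]/= -/(left_normed mul e (fun=> i) k.+1) IHk linearZl_LR /=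
  natural_basis_sqrM scalerA exprSr.
Qed.

Lemma coord_sum_neq (i j : 'I_n) :
  coord e j (\sum_(k < n | k != i) tnth e k) = (i != j)%:R.
Proof.
have e_free := basis_free eB.1.
rewrite linear_sum big_mkcond (bigD1 j) //= big1 ?addr0 => [|k /negPf kj].
  by rewrite (tnth_nth 0) coord_free // eqxx eq_sym; case: ifP.
by rewrite (tnth_nth 0) coord_free // eq_sym kj; case: ifP.
Qed.

Lemma coord_left_normed_const (i j : 'I_n) (k : nat) :
  left_normed mul e (fun=> i) k.+1 = \sum_(l < n | l != i) tnth e l ->
  a i i ^+ k * a i j = (i != j)%:R.
Proof.
move/(congr1 (coord e j)).
by rewrite left_normed_const linearZ /= coord_sum_neq [a i j]mxE.
Qed.

End LeftNormed.

Theorem proposition5p4 (R : realType) (E : vectType R[i])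
    (mul : {bilinear E -> E -> E}) (n : nat) (e : n.-tuple E)
    (n_gt0 : (0 < n)%N) (eB : natural_basis mul e)
    (natE : forall i j : 'I_n, exists m : nat, evolution_mx mul e i j = m%:R) :
  complete_evolution_algebra mul e <->
  exists k : nat, (1 <= k <= n)%N /\
    forall i : nat -> 'I_n,
      left_normed mul e i k = \sum_(j < n | j != i k) tnth e j.
Proof.
split=> [[_ aE] | [[|k] [//= k_lt_n prodE]]].
  exists 1%N; split=> // i /=; rewrite (evolution_mxP _ eB) aE [RHS]big_mkcond.
  apply: eq_bigr => j _; rewrite mxE /complete_graph eq_sym.
  by case: ifP; rewrite ?scale1r ?scale0r.
have aE i j : evolution_mx mul e i i ^+ k * evolution_mx mul e i j = (i != j)%:R.
  exact: coord_left_normed_const (prodE (fun=> i)).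
split=> // {prodE}; case: k k_lt_n aE => [|k] k_lt_n aE.
  by apply/matrixP=> i j; rewrite -[LHS]mul1r aE mxE.
have n_gt1 : (1 < n)%N by apply: leq_trans k_lt_n.
pose i := Ordinal n_gt0; pose j := Ordinal n_gt1.
have /eqP := aE i i; rewrite eqxx -exprSr expf_eq0 => /andP[_ /eqP aii0].
by have /eqP := aE i j; rewrite aii0 exprS !mul0r eq_sym oner_eq0.
Qed.
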